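(* Let $L=\mathrm{PSL}_n(q)$ be a finite simple linear group, where $q$ is a power of a prime $p$. Assume that $q>p$ and $n>11$. Then the prime graph $\mathrm{GK}(L)$ is not a split graph.
   Context: All graphs are simple and finite. A graph is split if its vertex set can be partitioned into a set inducing a complete graph (a clique) and an independent set; either set may be empty. For a finite group $G$, $\pi(G)$ denotes the set of prime divisors of $|G|$. The prime graph $\mathrm{GK}(G)$ has vertex set $\pi(G)$, and two distinct primes $r,s\in\pi(G)$ are adjacent if and only if $G$ has an element of order $rs$. *)

(* Defs.v *)
From HB Require Import structures.
From mathcomp Require Import all_boot all_order all_algebra all_fingroup all_solvable.

Set Implicit Arguments.
Unset Strict Implicit.
Unset Printing Implicit Defensive.

Import GRing.Theory.
Local Open Scope group_scope.

(* A finite simple graph is given by its adjacency relation [e] on a finType;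
   [e] is meant to be symmetric and irreflexive. *)
Definition split_graph (T : finType) (e : rel T) : Prop :=
  exists C I : {set T},
    [/\ C :|: I = [set: T],
        [disjoint C & I],
        {in C &, forall x y, x != y -> e x y} &
        {in I &, forall x y, ~~ e x y}].

Definition GK_vertex (gT : finGroupType) (G : {group gT}) : finType :=
  seq_sub (primes #|G|).

Definition GK (gT : finGroupType) (G : {group gT}) : rel (GK_vertex G) :=
  fun r s => (r != s) && [exists x in G, #[x] == (val r * val s)%N].

Lemma GK_sym (gT : finGroupType) (G : {group gT}) : symmetric (@GK gT G).
Proof. by move=> r s; rewrite /GK eq_sym mulnC. Qed.

Lemma GK_irr (gT : finGroupType) (G : {group gT}) : irreflexive (@GK gT G).
Proof. by move=> r; rewrite /GK eqxx. Qed.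

(* As {'GL_n[F]} consists of matrices of size n.-1.+1, SL 0 F and PSL 0 F
   are those of size 1. *)
Definition SL (n : nat) (F : finFieldType) : {set {'GL_n[F]}} :=
  [set g | (\det (GLval g) == 1)%R].

Lemma SL_group_set (n : nat) (F : finFieldType) : group_set (SL n F).
Proof.
apply/group_setP; split=> [|x y]; first by rewrite inE GL_1E det1.
by rewrite !inE GL_MxE det_mulmx => /eqP-> /eqP->; rewrite mulr1.
Qed.

Canonical SL_group (n : nat) (F : finFieldType) : {group {'GL_n[F]}} :=
  Group (SL_group_set n F).

Definition PSL (n : nat) (F : finFieldType) : {group coset_of 'Z(SL n F)} :=
  (SL n F / 'Z(SL n F))%G.

(* Main.v *)
Require Import Defs.
From mathcomp Require Import all_boot all_order all_algebra all_fingroup all_solvable.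
From mathcomp Require Import all_field all_character zify ring.

(** A split graph contains no two disjoint edges without an edge between them,
    so it suffices to exhibit such a pair in GK(L).  Write q = Q^t with t prime,
    which is possible as q > p.  Among n-3, ..., n there are k < l not divisible
    by t.  Zsigmondy's theorem, applied to the exponents tk and k over the base
    Q, gives two distinct primes modulo which q has order exactly k (this is
    where n > 11 excludes the exceptions), and similarly two primes for l.
    Two primes of order k are adjacent: a primitive root of unity whose order is
    their product has degree at most k <= n over F_q, which yields a suitable
    companion matrix.  A prime r of order k and a prime s of order l are not:
    commuting matrices A, B of orders r, s move subspaces of dimension k and l
    respectively, and k + l > n forces them to interact, so that k divides l,
    whereas k < l < 2k. *)

Set Implicit Arguments.
Unset Strict Implicit.
Unset Printing Implicit Defensive.

Import Order.TTheory GRing.Theory Num.Theory.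
Local Open Scope ring_scope.

Local Notation "''Phi_' n" := (Cyclotomic n).

(** * Zsigmondy's theorem *)

Lemma prod_horner_Cyclotomic (n : nat) (x : int) :
  (0 < n)%N -> \prod_(d <- divisors n) ('Phi_d).[x] = x ^+ n - 1.
Proof. by move=> n0; rewrite -horner_prod prod_Cyclotomic // !hornerE. Qed.

Lemma divisors_proper (d e : nat) :
    (0 < d)%N -> (e %| d)%N ->
  perm_eq [seq c <- divisors d | (c %| e)%N] (divisors e).
Proof.
move=> d0 de; have e0 : (0 < e)%N by exact: dvdn_gt0 de.
apply: uniq_perm; rewrite ?filter_uniq ?divisors_uniq // => c.
rewrite mem_filter -!dvdn_divisors //; case: (boolP (c %| e)%N) => //= ce.
exact: dvdn_trans ce de.
Qed.

(** Among the factors ['Phi_c(x)] of [x ^ d - 1], those with [c] dividing [e] multiply to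
    [x ^ e - 1]; as [e < d], ['Phi_d(x)] is one of the others. *)
Lemma dvdz_Cyclotomic (d e : nat) (x : int) :
    (0 < d)%N -> (e %| d)%N -> (e < d)%N ->
  (('Phi_d).[x] * (x ^+ e - 1) %| x ^+ d - 1)%Z.
Proof.
move=> d0 de ed; have e0 : (0 < e)%N by exact: dvdn_gt0 de.
rewrite -!prod_horner_Cyclotomic // (bigID (fun c => c %| e)%N) /=.
rewrite -[X in (_ %| X * _)%Z]big_filter (perm_big _ (divisors_proper d0 de)).
rewrite mulrC dvdz_mul // -big_filter (big_rem d) /=; last first.
  by rewrite mem_filter -dvdn_divisors // dvdnn andbT gtnNdvd.
exact: dvdz_mulr.
Qed.

(** Over [algC], ['Phi_n(x)] is the product of [x - w] over the primitive [n]-th roots of unity [w],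
    and [|w| = 1] bounds each factor. *)
Lemma normr_Cyclotomic_bounds (n x : nat) :
    (0 < n)%N -> (0 < x)%N ->
  (x%:R - 1) ^+ totient n <= `|('Phi_n).[x%:R : int]| <= (x%:R + 1) ^+ totient n.
Proof.
move=> n0 x0; have [z pz] := C_prim_root_exists n0.
have nz : `|z| = 1.
  apply/eqP; rewrite -(@pexpr_eq1 _ _ n) //.
  by rewrite -normrX (prim_expr_order pz) normr1.
have E : (`|('Phi_n).[x%:R]|)%:~R = \prod_(k < n | coprime k n) `|x%:R - z ^+ k| :> algC.
  rewrite intr_norm -horner_map /= (Cintr_Cyclotomic pz) /cyclotomic horner_prod normr_prod.
  by apply: eq_bigr => k _; rewrite !hornerE /= rmorph_nat.
have card (a : algC) : a ^+ totient n = \prod_(k < n | coprime k n) a.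
  rewrite prodr_const totient_count_coprime big_mkord; congr (_ ^+ _).
  rewrite -sum1_card [RHS]big_mkcond /=; apply: eq_bigr => i _.
  by rewrite -[_ \in _]/(coprime i n) coprime_sym; case: (coprime i n).
rewrite -!(ler_int algC) E !rmorphXn !card rmorphB rmorphD /= !rmorph_nat.
apply/andP; split; apply: ler_prod => k _.
  rewrite subr_ge0 ler1n x0 /=.
  by apply: le_trans (lerB_dist _ _); rewrite normrX nz expr1n normr_nat.
rewrite normr_ge0 /=; apply: le_trans (ler_normB _ _) _.
by rewrite normrX nz expr1n normr_nat.
Qed.

Lemma Cyclotomic_neq0 (n x : nat) : (0 < n)%N -> (1 < x)%N -> ('Phi_n).[x%:R] != 0 :> int.
Proof.
move=> n0 x1; rewrite -normr_gt0.
have /andP[le_ _] := normr_Cyclotomic_bounds n0 (ltnW x1).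
by apply: lt_le_trans le_; rewrite exprn_gt0 // subr_gt0 ltr1n.
Qed.

(** The [P']-part of a divisor [c] divides [m], so [c] can fail to divide [P ^ a * m] only by having
    the full [P]-part [P ^ a.+1]. *)
Lemma divisors_prime_power (P a m : nat) :
    prime P -> (0 < m)%N -> coprime P m ->
  perm_eq [seq c <- divisors (P ^ a.+1 * m)%N | ~~ (c %| P ^ a * m)%N]
          [seq (P ^ a.+1 * c)%N | c <- divisors m].
Proof.
move=> prP m0 coPm; have P0 := prime_gt0 prP.
have PX b : (0 < P ^ b)%N by rewrite expn_gt0 P0.
apply: uniq_perm; first by rewrite filter_uniq ?divisors_uniq.
  rewrite map_inj_uniq ?divisors_uniq // => u v /eqP.
  by rewrite eqn_pmul2l ?PX // => /eqP.
move=> c; rewrite mem_filter -dvdn_divisors ?muln_gt0 ?PX //.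
apply/andP/mapP => [[nc /dvdnP[k ck]]|[e]]; last first.
  rewrite -dvdn_divisors // => em ->; split; last by rewrite dvdn_pmul2l ?PX.
  rewrite expnS -mulnA mulnCA dvdn_pmul2l ?PX //.
  apply/negP => /(dvdn_trans (dvdn_mulr _ (dvdnn P))) => Pm.
  by move: coPm; rewrite prime_coprime // Pm.
have cd : (c %| P ^ a.+1 * m)%N by rewrite ck dvdn_mull.
have c0 : (0 < c)%N by apply: dvdn_gt0 cd; rewrite muln_gt0 PX.
have cE : c = (P ^ logn P c * c`_P^')%N by rewrite -p_part partnC.
have cm : (c`_P^' %| m)%N.
  move: (cd); rewrite {1}cE => /(dvdn_trans (dvdn_mull _ (dvdnn _))).
  rewrite Gauss_dvdr //; apply: coprimeXr.
  by rewrite coprime_sym prime_coprime // -[(_ %| _)%N]negbK -p'natE ?part_gt0 // part_pnat.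
have lc : (logn P c <= a.+1)%N.
  have := dvdn_leq_log P (n := (P ^ a.+1 * m)%N) _ cd.
  rewrite muln_gt0 PX m0 => /(_ isT); rewrite lognM ?PX // pfactorK //.
  by rewrite [logn P m]logn_coprime ?addn0.
have la : logn P c = a.+1.
  apply/eqP; rewrite eqn_leq lc leqNgt; apply/negP => la; case/negP: nc.
  by rewrite cE dvdn_mul // dvdn_exp2l.
by exists (c`_P^')%N; rewrite -?dvdn_divisors // -la.
Qed.

(* Both sides have the same product over the divisors of [m], so the identity
   follows by induction on [m] after cancelling the nonzero other factors. *)
Lemma Cyclotomic_prime_power (P a m x : nat) (y := (x ^ (P ^ a))%N) :
    prime P -> (0 < m)%N -> coprime P m -> (1 < x)%N ->
  ('Phi_(P ^ a.+1 * m)).[x%:R] * ('Phi_m).[y%:R] = ('Phi_m).[(y ^ P)%:R] :> int.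
Proof.
move=> prP + + x1; have P0 := prime_gt0 prP.
have PX b : (0 < P ^ b)%N by rewrite expn_gt0 P0.
have y1 : (1 < y)%N by rewrite /y -(exp1n (P ^ a)) ltn_exp2r ?PX.
have yP1 : (1 < y ^ P)%N by rewrite -(exp1n P) ltn_exp2r.
elim/ltn_ind: m => m IH m0 coPm.
pose L c := ('Phi_(P ^ a.+1 * c)).[x%:R] * ('Phi_c).[y%:R] : int.
pose M c := ('Phi_c).[(y ^ P)%:R] : int.
(* Over the divisors [c] of [m], the values at [x] multiply to [x ^ (P ^ a.+1 * m) - 1] divided by
   [x ^ (P ^ a * m) - 1], and this divisor is [y ^ m - 1], the product of the values at [y]. *)
have LM : \prod_(c <- divisors m) L c = \prod_(c <- divisors m) M c.
  rewrite prod_horner_Cyclotomic // big_split /= prod_horner_Cyclotomic //.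
  have D : (0 < P ^ a.+1 * m)%N by rewrite muln_gt0 PX.
  have D' : (0 < P ^ a * m)%N by rewrite muln_gt0 PX.
  have dv : (P ^ a * m %| P ^ a.+1 * m)%N by rewrite dvdn_pmul2r // dvdn_exp2l.
  have := prod_horner_Cyclotomic (x%:R : int) D.
  rewrite (bigID (fun c => c %| P ^ a * m)%N) /=.
  rewrite -[X in (X * _)]big_filter (perm_big _ (divisors_proper D dv)).
  rewrite -[X in (_ * X)]big_filter (perm_big _ (divisors_prime_power a prP m0 coPm)).
  rewrite prod_horner_Cyclotomic // big_map mulrC => E.
  by rewrite !natrX -!exprM -expnSr E.
move: LM; have mm : m \in divisors m by rewrite -dvdn_divisors.
rewrite !(big_rem m mm) /= => LM.
suff E : \prod_(c <- rem m (divisors m)) L c = \prod_(c <- rem m (divisors m)) M c.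
  move: LM; rewrite E => /mulIf; apply.
  rewrite prodf_seq_neq0; apply/allP => c /mem_rem; rewrite -dvdn_divisors // => cm.
  by apply: Cyclotomic_neq0 => //; exact: dvdn_gt0 cm.
apply: eq_big_seq => c; rewrite mem_rem_uniq ?divisors_uniq // !inE.
rewrite -dvdn_divisors // => /andP[cm cdm].
have c0 : (0 < c)%N by exact: dvdn_gt0 cdm.
apply: IH => //; first by rewrite ltn_neqAle cm dvdn_leq.
exact: coprime_dvdr coPm.
Qed.

(* For [0 < x] (so that the truncated subtraction is harmless) this says that
   [x] has multiplicative order [e] modulo [s]. *)
Definition has_order_mod (s x e : nat) :=
  forall j : nat, (s %| x ^ j - 1)%N = (e %| j)%N.

(** [e] is the order of [x] in the multiplicative group of ['F_s], so it divides [s.-1] by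
    Fermat. *)
Lemma has_order_mod_exists (s x d : nat) :
    prime s -> (0 < x)%N -> (0 < d)%N -> (s %| x ^ d - 1)%N ->
  exists2 e, has_order_mod s x e & (e %| d)%N && (e %| s.-1)%N.
Proof.
move=> prs x0 d0 sxd.
have E j : (s %| x ^ j - 1)%N = ((x%:R : 'F_s) ^+ j == 1).
  rewrite (dvdn_pcharf (pchar_Fp prs)) natrB ?expn_gt0 ?x0 //.
  by rewrite natrX subr_eq0.
have xd : (x%:R : 'F_s) ^+ d = 1 by apply/eqP; rewrite -E.
have [e pe ed] := prim_order_exists d0 xd.
have H : has_order_mod s x e by move=> j; rewrite E (prim_order_dvd pe).
exists e => //; rewrite ed -H E.
have nz : (x%:R : 'F_s) != 0.
  by apply: contra_eq_neq xd => ->; rewrite expr0n eqn0Ngt d0 eq_sym oner_neq0.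
rewrite -(inj_eq (mulIf nz)) /= mul1r -exprSr prednK ?prime_gt0 //.
by have := expf_card (x%:R : 'F_s); rewrite card_Fp // => ->.
Qed.

Lemma dvdz_geometric_sub (z : int) (r : nat) :
  (z - 1 %| \sum_(i < r) z ^+ i - r%:R)%Z.
Proof.
have -> : \sum_(i < r) z ^+ i - r%:R = \sum_(i < r) (z ^+ i - 1).
  by rewrite sumrB sumr_const card_ord.
by apply: rpred_sum => i _; rewrite subrX1 dvdz_mulr.
Qed.

(** Modulo [(z - 1) ^ 2], each [z ^ i] is [1 + i (z - 1)], and the [i < r] sum to ['C(r, 2)]. *)
Lemma dvdz_geometric_sub2 (z : int) (r : nat) :
  ((z - 1) ^+ 2 %| \sum_(i < r) z ^+ i - (r%:R + (z - 1) * 'C(r, 2)%:R))%Z.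
Proof.
have H i : ((z - 1) ^+ 2 %| z ^+ i - (1 + (z - 1) * i%:R))%Z.
  elim: i => [|i IH]; first by rewrite mulr0 addr0 subrr dvdz0.
  have -> : z ^+ i.+1 - (1 + (z - 1) * i.+1%:R) =
     z * (z ^+ i - (1 + (z - 1) * i%:R)) + i%:R * (z - 1) ^+ 2.
    by rewrite exprS -natr1; ring.
  by apply: rpredD; apply: dvdz_mull; rewrite ?dvdzz.
have -> : \sum_(i < r) z ^+ i - (r%:R + (z - 1) * 'C(r, 2)%:R) =
    \sum_(i < r) (z ^+ i - (1 + (z - 1) * i%:R)).
  rewrite sumrB big_split /= sumr_const card_ord -mulr_sumr -bin2_sum.
  by rewrite big_mkord natr_sum.
by apply: rpred_sum.
Qed.

(** The sum is the quotient of [x ^ d - 1] by [x ^ (d %/ r) - 1], so [dvdz_Cyclotomic] applies after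
    cancelling. *)
Lemma dvdz_Cyclotomic_geometric (d r x : nat) :
    (0 < d)%N -> prime r -> (r %| d)%N -> (1 < x)%N ->
  (('Phi_d).[x%:R : int] %| \sum_(i < r) ((x ^ (d %/ r))%:R : int) ^+ i)%Z.
Proof.
move=> d0 prr rd x1.
have dr0 : (0 < d %/ r)%N by rewrite divn_gt0 ?prime_gt0 // dvdn_leq.
have := @dvdz_Cyclotomic d (d %/ r) x%:R d0 (dvdn_div rd).
rewrite ltn_Pdiv ?prime_gt1 // => /(_ isT).
rewrite -[in X in (_ %| X)%Z -> _](divnK rd) exprM -natrX subrX1 mulrC.
have nz : (x ^ (d %/ r))%:R - 1 != 0 :> int.
  rewrite subr_eq0 -[1]/(1%:R) eqr_nat neq_ltn; apply/orP; right.
  by rewrite -(exp1n (d %/ r)) ltn_exp2r.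
by rewrite (dvdz_mul2r nz).
Qed.

(** * Prime divisors of ['Phi_d(x)] modulo which [x] has order less than [d] *)

Section NonPrimitiveDivisor.

Variables (x d s e : nat).
Hypotheses (x1 : (1 < x)%N) (d2 : (2 < d)%N) (prs : prime s).
Hypothesis s_dvd : (s%:Z %| ('Phi_d).[x%:R])%Z.
Hypotheses (ord_e : has_order_mod s x e) (e_d : (e %| d)%N) (e_neq : e != d).

Let d0 : (0 < d)%N. Proof. by apply: leq_trans d2. Qed.

Let dvdX (j : nat) : (s%:Z %| (x ^ j)%:R - 1)%Z = (e %| j)%N.
Proof.
rewrite -ord_e -[1]/(1%:R) -natrB ?expn_gt0 ?(ltnW x1) //.
by rewrite natz.
Qed.

(** Modulo [s] the power [x ^ (d %/ r)] is 1, so the geometric sum of length [r], a multiple of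
    ['Phi_d(x)] and hence of [s], is congruent to [r]. *)
Lemma order_quotient_prime (r : nat) : prime r -> (r %| d %/ e)%N -> r = s.
Proof.
move=> prr rde.
have e0 : (0 < e)%N by exact: dvdn_gt0 e_d.
have erd : (e * r %| d)%N by rewrite -(divnK e_d) mulnC dvdn_pmul2r.
have rd : (r %| d)%N by apply: dvdn_trans erd; exact: dvdn_mull.
have edr : (e %| d %/ r)%N by rewrite dvdn_divRL // mulnC.
have sK := dvdz_trans s_dvd (dvdz_Cyclotomic_geometric d0 prr rd x1).
rewrite -dvdX in edr.
have := rpredB sK (dvdz_trans edr (dvdz_geometric_sub _ r)).
rewrite subKr natz dvdzE /= => sr.
by apply/esym/eqP; rewrite -dvdn_prime2.
Qed.

(** Every prime factor of [d %/ e] is [s], and those of [e] are smaller since [e] divides [s.-1].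
    The square of [s] is excluded by computing the geometric sum of length [s] modulo [s ^ 2]. *)
Lemma non_primitive_divisor :
  s = max_pdiv d /\ ~~ ((s ^ 2)%N%:Z %| ('Phi_d).[x%:R])%Z.
Proof.
have e0 : (0 < e)%N by exact: dvdn_gt0 e_d.
have es : (e %| s.-1)%N.
  have sxd : (s %| x ^ d - 1)%N by rewrite ord_e.
  have [e' oe' /andP[_ ]] := has_order_mod_exists prs (ltnW x1) d0 sxd.
  by rewrite -oe' ord_e.
have de1 : (1 < d %/ e)%N.
  by rewrite ltn_divRL // mul1n ltn_neqAle e_neq dvdn_leq.
have sde : (s %| d %/ e)%N.
  rewrite -{1}(order_quotient_prime (pdiv_prime de1) (pdiv_dvd _)).
  exact: pdiv_dvd.
have sd : (s %| d)%N by apply: dvdn_trans sde (dvdn_div e_d).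
have les u : prime u -> (u %| d)%N -> (u <= s)%N.
  move=> pru; rewrite -(divnK e_d) Euclid_dvdM // => /orP[ude|ue].
    by rewrite (order_quotient_prime pru ude).
  apply: leq_trans (dvdn_leq e0 ue) _.
  apply: leq_trans (dvdn_leq _ es) (leq_pred _).
  by rewrite -subn1 subn_gt0 prime_gt1.
have smax : s = max_pdiv d.
  apply/eqP; rewrite eqn_leq max_pdiv_max ?mem_primes ?prs ?d0 //=.
  by rewrite les ?max_pdiv_prime ?max_pdiv_dvd // ltnW.
split=> //; apply/negP => s2.
have {s2} s2K := dvdz_trans s2 (dvdz_Cyclotomic_geometric d0 prs sd x1).
(* For [s = 2], the number [d %/ 2] is even because [d > 2] has no odd prime factor; the sum is then
   [1 + w ^ 2], never a multiple of 4. *)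
have [s_odd|s_even] := boolP (odd s); last first.
  have s2 : s = 2 by case: (even_prime prs) => // so; rewrite so in s_even.
  have [dh|dh] := boolP (odd (d %/ 2)).
    have dh1 : (1 < d %/ 2)%N by rewrite ltn_divRL ?mul1n //; rewrite s2 in sd.
    have d2d : (d %/ 2 %| d)%N by rewrite dvdn_div //; rewrite s2 in sd.
    have := les _ (pdiv_prime dh1) (dvdn_trans (pdiv_dvd _) d2d).
    rewrite s2 => p2; have := pdiv_dvd (d %/ 2).
    suff -> : pdiv (d %/ 2) = 2 by rewrite dvdn2 dh.
    by apply/eqP; rewrite eqn_leq p2 prime_gt1 // pdiv_prime.
  move: s2K; rewrite s2 big_ord_recr big_ord_recr big_ord0 /= add0r expr0 expr1.
  have -> : (d %/ 2 = (d %/ 2)./2 * 2)%N by rewrite muln2 even_halfK.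
  rewrite expnM; set w := (x ^ _)%N.
  rewrite dvdzE /= => dv; have {dv} : (4 %| 1 + w ^ 2)%N by move: dv; rewrite natz.
  rewrite -[w]odd_double_half; move: (w./2) => v; case: (odd w) => /=; clear; nia.
(* For odd [s], put [u = x ^ (d %/ s) - 1]. Modulo [s ^ 2] the sum is [s + u * 'C(s, 2)], and [s]
   divides both [u] and ['C(s, 2)], which would leave [s ^ 2] dividing [s]. *)
have s2 : (2 < s)%N by rewrite ltn_neqAle prime_gt1 // andbT; apply: contraTneq s_odd => <-.
have su : (s%:Z %| (x ^ (d %/ s))%:R - 1)%Z.
  have esd : (e * s %| d)%N by rewrite -(divnK e_d) mulnC dvdn_pmul2r.
  by rewrite dvdX dvdn_divRL // mulnC.
have := dvdz_trans (dvdz_exp2r 2 su) (dvdz_geometric_sub2 _ s).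
rewrite expr2 => s2S; have := rpredB s2K s2S.
rewrite subKr => s2r.
have sC : (s%:Z %| 'C(s, 2)%:R)%Z by rewrite natz dvdzE /= prime_dvd_bin.
have := rpredB s2r (dvdz_mul su sC); rewrite addrK natz dvdzE /=.
move=> /(dvdn_leq (prime_gt0 prs)); rewrite leqNgt -{1}(expn1 s) ltn_exp2l //.
exact: prime_gt1.
Qed.

End NonPrimitiveDivisor.

(** * Size of ['Phi_d(x)] and existence of primitive prime divisors *)

Lemma prime_divisors_unique_dvdn (N P : nat) : (0 < N)%N ->
    (forall u, prime u -> (u %| N)%N -> u = P /\ ~~ (u ^ 2 %| N)%N) ->
  (N %| P)%N.
Proof.
move=> N0 H; have [N1|N1] := leqP N 1; first by rewrite (_ : N = 1)%N // ; lia.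
have [] := H _ (pdiv_prime N1) (pdiv_dvd N); move: (pdiv_dvd N) (pdiv_prime N1) => + + E.
rewrite E => /dvdnP[k NE] prP; rewrite {1}NE expnS expn1 dvdn_pmul2r ?prime_gt0 //.
have [k1|k1] := leqP k 1.
  by have k2 : k = 1%N; [nia | rewrite NE k2 mul1n].
case/negP.
have kN : (pdiv k %| N)%N by rewrite NE dvdn_mulr // pdiv_dvd.
by have [<- _] := H _ (pdiv_prime k1) kN; rewrite pdiv_dvd.
Qed.

Lemma expn_gap_mono (A B P c f : nat) :
    (0 < B)%N -> (B <= A)%N -> (c <= f)%N -> (P * B ^ c < A ^ c)%N ->
  (P * B ^ f < A ^ f)%N.
Proof.
move=> B0 BA cf H; have A0 := leq_trans B0 BA.
rewrite -(subnKC cf) !expnD mulnA.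
apply: (@leq_ltn_trans (P * B ^ c * A ^ (f - c))).
  rewrite leq_mul2l; apply/orP; right.
  by have [->|fc] := posnP (f - c)%N; rewrite ?expn0 // leq_exp2r.
by rewrite ltn_pmul2r // expn_gt0 A0.
Qed.

(** For prime [P], the pairs [(P, y)] left out are [(2, 2)], [(2, 3)] and [(3, 2)], for which the
    inequality fails. *)
Lemma expn_gap (P y : nat) : (1 < y)%N ->
    [|| 3 < P, (P == 3) && (2 < y) | (P == 2) && (3 < y)]%N ->
  (P * (y + 1) < y ^ P - 1)%N.
Proof.
move=> y1 /or3P[P3|/andP[/eqP-> y2]|/andP[/eqP-> y3]].
- rewrite -(subnKC P3); elim: (P - 4)%N => [|k IH].
    have y3 : (2 * 2 * 2 <= y * y * y)%N by rewrite !leq_mul.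
    rewrite addn0 !expnS expn0 muln1; have := leq_mul (leqnn y) y3.
    by rewrite !mulnA; lia.
  have y0 : (0 < y ^ (4 + k))%N by rewrite expn_gt0 ltnW.
  by rewrite addnS expnS; nia.
- by rewrite !expnS expn0 muln1; nia.
- by rewrite !expnS expn0 muln1; nia.
Qed.

(* With [d = P ^ a.+1 * m] and [y = x ^ (P ^ a)], the quotient formula
   ['Phi_d(x) = 'Phi_m(y ^ P) / 'Phi_m(y)] bounds ['Phi_d(x)] below by the
   [totient m]-th power of [(y ^ P - 1) / (y + 1)]. *)
Lemma Cyclotomic_gt_max_pdiv (x d : nat) : (1 < x)%N -> (6 < d)%N ->
  ((max_pdiv d)%:R < `|('Phi_d).[x%:R : int]|).
Proof.
move=> x1 d6; have d1 : (1 < d)%N by lia.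
set P := max_pdiv d; have prP : prime P by exact: max_pdiv_prime.
have P0 := prime_gt0 prP; have P1 := prime_gt1 prP.
have Pd : (P %| d)%N by exact: max_pdiv_dvd.
have d0 : (0 < d)%N by lia.
pose a := (logn P d).-1; pose m := (d`_P^')%N.
have aE : logn P d = a.+1 by rewrite prednK // logn_gt0 mem_primes prP d0.
have dE : d = (P ^ a.+1 * m)%N by rewrite -aE -p_part partnC.
have coPm : coprime P m.
  by rewrite prime_coprime // -p'natE ?part_gt0 // part_pnat.
have m0 : (0 < m)%N by exact: part_gt0.
pose y := (x ^ (P ^ a))%N.
have xy : (x <= y)%N by rewrite -{1}(expn1 x) leq_exp2l // expn_gt0 P0.
have y1 : (1 < y)%N by exact: leq_trans xy.
pose f := totient m; have f0 : (0 < f)%N by rewrite totient_gt0.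
suff big : (P * (y + 1) ^ f < (y ^ P - 1) ^ f)%N.
  have yP0 : (0 < y ^ P)%N by rewrite expn_gt0 ltnW.
  have := Cyclotomic_prime_power a prP m0 coPm x1; rewrite -dE -/y => E.
  have /andP[_ up] := normr_Cyclotomic_bounds m0 (ltnW y1).
  have /andP[lo _] := normr_Cyclotomic_bounds m0 yP0.
  rewrite ltNge; apply/negP => le_.
  have := le_trans lo; rewrite -E normrM => /(_ _ (ler_pM _ _ le_ up)).
  rewrite !normr_ge0 => /(_ isT isT).
  have -> : (y ^ P)%:R - 1 = (y ^ P - 1)%:R :> int by rewrite natrB.
  have -> : y%:R + 1 = (y + 1)%:R :> int by rewrite natrD.
  by rewrite -!natrX -natrM ler_nat leqNgt big.
have [gap|] := boolP (P * (y + 1) < y ^ P - 1)%N.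
  apply: (@expn_gap_mono _ _ _ 1); rewrite ?expn1 ?addn_gt0 ?orbT //.
  by apply: leq_trans (ltnW gap); rewrite leq_pmull.
move/(contraNN (expn_gap y1)); rewrite !negb_or !negb_and -!leqNgt.
case/and3P => P3 /orP P3' /orP P2'.
(* In the exceptional pairs [d > 6] helps. If [P = 2], then [d] is a power of 2, at least 8, which
   makes [y] at least 16. If [P = 3] and [y = 2], then [d = 3 * m] with [m > 2], so [f] is at least
   2 and [3 * 3 ^ 2 < 7 ^ 2] suffices. *)
have [P2|P3E] : P = 2 \/ P = 3 by lia.
  have m1 : m = 1%N.
    apply/eqP; rewrite eqn_leq m0 andbT leqNgt; apply/negP => m1.
    have := coPm; rewrite prime_coprime // => /negP[].
    suff <- : pdiv m = P by exact: pdiv_dvd.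
    apply/eqP; rewrite eqn_leq; apply/andP; split.
      apply: max_pdiv_max; rewrite mem_primes pdiv_prime // d0 dE.
      by rewrite dvdn_mull // pdiv_dvd.
    by rewrite P2 prime_gt1 // pdiv_prime.
  have a2 : (1 < a)%N.
    move: d6; rewrite dE m1 muln1 P2; case: (a) => [|[|]] //.
  have : (2 ^ 4 <= y)%N.
    apply: (@leq_trans (x ^ 4)); first by rewrite leq_exp2r.
    by rewrite leq_exp2l // P2 (@leq_pexp2l 2 2 a isT a2).
  by move=> y16; case: P2' => ?; lia.
have y2 : y = 2 by case: P3' => ?; lia.
have a0 : a = 0.
  case: (posnP a) => // a0; have : (2 ^ 3 <= y)%N; last by lia.
  apply: (@leq_trans (x ^ 3)); first by rewrite leq_exp2r.
  by rewrite leq_exp2l // P3E (@leq_pexp2l 3 1 a isT a0).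
have f1 : (1 < f)%N.
  by rewrite totient_gt1; move: d6; rewrite dE a0 P3E; lia.
by apply: (@expn_gap_mono _ _ _ 2) => //; rewrite y2 ?P3E.
Qed.

(** If no prime divisor of ['Phi_d(x)] were primitive, [max_pdiv d] would be the only one and occur
    once, so ['Phi_d(x)] would be too small. The bound on [d] avoids the exception [x = 2],
    [d = 6]. *)
Theorem Zsigmondy (x d : nat) : (1 < x)%N -> (6 < d)%N ->
  exists2 r, prime r & has_order_mod r x d.
Proof.
move=> x1 d6; have d1 : (1 < d)%N by lia.
pose N := `|('Phi_d).[x%:R : int]|%N.
have d0 : (0 < d)%N by lia.
have N0 : (0 < N)%N by rewrite absz_gt0 Cyclotomic_neq0.
have big : (max_pdiv d < N)%N.
  by have := Cyclotomic_gt_max_pdiv x1 d6; rewrite -abszE (natz (max_pdiv d)) ltz_nat.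
have Nd : (N %| x ^ d - 1)%N.
  have := @dvdz_Cyclotomic d 1 x%:R d0 (dvd1n _) d1.
  move/(dvdz_trans (dvdz_mulr _ (dvdzz _))).
  have -> : x%:R ^+ d - 1 = (x ^ d - 1)%N :> int.
    by rewrite -natrX -[1]/(1%:R) -natrB ?expn_gt0 ?(ltnW x1) // natz.
  by rewrite dvdzE.
(* A boolean form of [has_order_mod u x d] for primes dividing [x ^ d - 1]: no proper divisor of [d]
   works. *)
pose prim u := all (fun e => (u %| x ^ e - 1)%N ==> (e == d)) (divisors d).
have [/hasP[u]|/hasPn noprim] := boolP (has prim (primes N)).
  rewrite mem_primes => /and3P[pru _ uN] /allP pu; exists u => //.
  have ud := dvdn_trans uN Nd.
  have [e oe /andP[ed _]] := has_order_mod_exists pru (ltnW x1) d0 ud.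
  have := pu e; rewrite -dvdn_divisors // => /(_ ed); rewrite oe dvdnn /=.
  by move=> /eqP <-.
move: big; rewrite ltnNge dvdn_leq ?max_pdiv_prime ?prime_gt0 ?max_pdiv_prime //.
apply: prime_divisors_unique_dvdn => // u pru uN.
have ud := dvdn_trans uN Nd.
have [e oe /andP[ed _]] := has_order_mod_exists pru (ltnW x1) d0 ud.
have [ee|ne] := eqVneq e d.
  have := noprim u; rewrite mem_primes pru N0 uN => /(_ isT) /negP[].
  apply/allP => c; rewrite -dvdn_divisors // => cd; apply/implyP.
  by rewrite oe ee eqn_dvd cd.
by have := @non_primitive_divisor x d u e x1 _ pru _ oe ed ne; apply => //; lia.
Qed.

(** * Elements of PSL *)

Lemma det_transvection (R : comNzRingType) (n : nat) (i j : 'I_n) :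
  i != j -> \det (1%:M + delta_mx i j : 'M[R]_n) = 1.
Proof.
wlog ji : i j / (j < i)%N => [H ij|ij].
  have [ji|ji|/val_inj ji] := ltngtP j i; first exact: H.
    by rewrite -det_tr linearD /= trmx1 trmx_delta H // eq_sym.
  by rewrite ji eqxx in ij.
rewrite det_trig; last first.
  apply/is_trig_mxP => a b ab; rewrite !mxE.
  have -> : (a == b) = false by apply: contraTF ab => /eqP->; rewrite ltnn.
  rewrite add0r; case: eqP => //= ai; case: eqP => //= bj.
  by move: ab; rewrite ai bj ltnNge (ltnW ji).
rewrite big1 // => a _; rewrite !mxE eqxx.
case: (eqVneq a i) => [->|_] /=; last by rewrite addr0.
by rewrite (negPf ij) addr0.
Qed.

Lemma comm_delta_mx_scalar (R : nzRingType) (n : nat) (A : 'M[R]_n.+1) :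
    (forall i j, i != j -> A *m delta_mx i j = delta_mx i j *m A) ->
    (0 < n)%N ->
  A = (A 0 0)%:M.
Proof.
move=> H n0.
have E a b i j : i != j -> A a i * (b == j)%:R = (a == i)%:R * A j b.
  move=> /H /matrixP /(_ a b); rewrite !mxE (bigD1 i) //= big1 ?addr0; last first.
    by move=> c ci; rewrite mxE (negPf ci) /= mulr0.
  rewrite (bigD1 j) //= big1 ?addr0; last first.
    by move=> c cj; rewrite mxE (negPf cj) andbF mul0r.
  by rewrite !mxE !eqxx /= andbT.
have other (i : 'I_n.+1) : exists j, i != j.
  have [->|i0] := eqVneq i 0; last by exists 0.
  by exists ord_max; rewrite -val_eqE /= neq_ltn n0.
apply/matrixP => a b; rewrite !mxE.
have [ab|ab] := eqVneq a b; last first.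
  have [j bj] := other b; have := E a j b j bj.
  by rewrite eqxx mulr1 (negPf ab) mul0r mulr0n.
rewrite -{}ab mulr1n.
have [->//|a0] := eqVneq a 0.
by have := E a 0 a 0 a0; rewrite !eqxx mulr1 mul1r.
Qed.

Lemma GLvalX (n : nat) (F : finFieldType) (g : {'GL_n[F]}) (m : nat) :
  GLval (g ^+ m)%g = GLval g ^+ m.
Proof. by elim: m => [|m IH] //; rewrite expgS GL_ME IH exprS. Qed.

(** Commuting with the transvections, which lie in SL, forces [z] to be scalar. *)
Lemma center_SL_exp (n : nat) (F : finFieldType) (z : {'GL_n[F]}) :
  (1 < n)%N -> (z \in 'Z(SL n F))%g -> (z ^+ #|F|.-1 = 1)%g.
Proof.
case: n z => [|[|n]] // z _ /centerP[_ cz].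
have [c sc] : exists c, GLval z = c%:M.
  exists (GLval z 0 0); apply: comm_delta_mx_scalar => // i j ij.
  pose T : 'M[F]_n.+2 := 1%:M + delta_mx i j.
  have detT : \det T = 1 by exact: det_transvection.
  have uT : T \is a GRing.unit by rewrite unitmxE detT unitr1.
  pose t : {'GL_n.+2[F]} := FinRing.unit 'M[F]_n.+2 uT.
  have tS : t \in SL n.+2 F by rewrite inE detT.
  have := congr1 (@GLval _ _) (cz t tS); rewrite !GL_MxE /= /T.
  by rewrite mulmxDr mulmxDl mulmx1 mul1mx => /addrI.
have z0 : c != 0.
  have := GL_unit z; rewrite sc unitmxE det_scalar unitfE.
  by apply: contraNneq => ->; rewrite expr0n.
apply: val_inj; rewrite /=.
rewrite [LHS]GLvalX sc -rmorphXn /=.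
have -> : c ^+ #|F|.-1 = 1.
  apply: (mulIf z0); rewrite mul1r -exprSr prednK ?expf_card //.
  by apply/card_gt0P; exists 0.
by [].
Qed.

(** * Matrices of prime order acting without nonzero fixed vectors *)

Section FixedPointFree.

Variables (F : finFieldType) (n' : nat).
Local Notation n := n'.+1.

Lemma mulmx_exprS (v : 'rV[F]_n) (g : 'M[F]_n) (j : nat) :
  v *m g ^+ j.+1 = (v *m g ^+ j) *m g.
Proof. by rewrite exprSr mulmxA. Qed.

(** The powers of [g] form an [r]-group permuting the vectors of [W], and 0 is the only fixed point;
    count modulo [r]. *)
Lemma fixed_point_free_dvdn (m r : nat) (W : 'M[F]_(m, n)) (g : 'M[F]_n) :
    prime r -> g ^+ r = 1 -> (W *m g <= W)%MS ->
    (forall v : 'rV[F]_n, (v <= W)%MS -> v *m g = v -> v = 0) ->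
  (r %| #|F| ^ \rank W - 1)%N.
Proof.
move=> prr gr Wg fpf.
have injg : injective (fun v : 'rV[F]_n => v *m g).
  have : g \in unitmx.
    apply: (@mulmx1_unit _ _ g (g ^+ r.-1) _).1.
    by rewrite -[RHS]gr -[in RHS](prednK (prime_gt0 prr)) exprS.
  by move=> ug; apply: can_inj (mulmxK ug).
pose s : {perm 'rV[F]_n} := perm injg.
have sX v j : (s ^+ j)%g v = v *m g ^+ j.
  elim: j => [|j IH]; first by rewrite perm1 mulmx1.
  by rewrite expgSr permM IH permE mulmx_exprS.
have rG : (r.-group <[s]>)%g.
  apply: (@pnat_dvd _ r); last exact: pnat_id.
  by rewrite order_dvdn; apply/eqP/permP => v; rewrite sX gr mulmx1 perm1.
have gv (v : 'rV[F]_n) : (v *m g <= W)%MS = (v <= W)%MS.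
  apply/idP/idP => vW; last exact: submx_trans (submxMr _ vW) Wg.
  have stab j (u : 'rV[F]_n) : (u <= W)%MS -> (u *m g ^+ j <= W)%MS.
    elim: j => [|j IH] uW; first by rewrite mulmx1.
    by rewrite mulmx_exprS; exact: submx_trans (submxMr _ (IH uW)) Wg.
  have := stab r.-1 _ vW.
  by rewrite -mulmxA -[g *m _]exprS prednK ?prime_gt0 // gr mulmx1.
have acts : [acts <[s]>%g, on rowg W | 'P].
  rewrite cycle_subG; apply/astabsP => v.
  by rewrite !mem_rowg /= apermE permE gv.
have := pgroup_fix_mod rG acts; rewrite card_rowg.
have -> : ('Fix_(rowg W | 'P)(<[s]>) = [set 0])%g.
  apply/setP => v; rewrite in_setI mem_rowg in_set1 afix_cycle_in; last by rewrite inE.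
  apply/andP/eqP => [[vW /afix1P]|->]; last first.
    by rewrite sub0mx; split=> //; apply/afix1P; rewrite /= apermE permE mul0mx.
  by rewrite /= apermE permE; exact: fpf.
rewrite cards1 => /eqP; rewrite eqn_mod_dvd // expn_gt0.
by apply/orP; left; apply/card_gt0P; exists 0.
Qed.

(** Writing [v = w (B - 1)] gives [w B ^ i = w + i v]; at [i = s] this reads [s v = 0]. *)
Lemma fixed_image_eq0 (s : nat) (B : 'M[F]_n) (v : 'rV[F]_n) :
    s%:R != 0 :> F -> B ^+ s = 1 -> (v <= B - 1)%MS -> v *m B = v ->
  v = 0.
Proof.
move=> s0 Bs /submxP[w vE] vB.
have H i : w *m B ^+ i = w + i%:R *: v.
  elim: i => [|i IH]; first by rewrite mulmx1 scale0r addr0.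
  rewrite mulmx_exprS IH mulmxDl -scalemxAl vB -natr1 scalerDl scale1r addrA addrAC.
  by congr (_ + _); rewrite vE mulmxBr mulmx1 addrC subrK.
have := H s; rewrite Bs mulmx1 => /eqP; rewrite -{1}[w]addr0 (inj_eq (addrI w)) eq_sym.
by rewrite scaler_eq0 (negPf s0) => /eqP.
Qed.

(** [s] divides [#|F| ^ l - 1], whose image in [F] is -1. *)
Lemma has_order_natr_neq0 (s l : nat) :
  prime s -> (0 < l)%N -> has_order_mod s #|F| l -> s%:R != 0 :> F.
Proof.
move=> prs l0 os; apply/negP => /eqP s0.
have q0 : #|F|%:R = 0 :> F.
  by have := expg_cardG (in_setT (1 : F)); rewrite FinRing.zmodXgE cardsT.
have := os l; rewrite dvdnn => /dvdnP[c /(congr1 (fun x => x%:R : F))].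
rewrite natrM s0 mulr0 natrB ?natrX ?q0 ?expr0n ?eqn0Ngt ?l0 ?sub0r; last first.
  by rewrite expn_gt0; apply/orP; left; apply/card_gt0P; exists 0.
by move/eqP; rewrite oppr_eq0 oner_eq0.
Qed.

(* The image of [B - 1] has dimension exactly [l].  Its intersection with the
   fixed space of [A] has dimension [0] or [l], as [B] acts on it without fixed
   points; [l] is too large, and [0] makes [A] act without fixed points on the
   image of [B - 1]. *)
Lemma commuting_large_orders (r s k l : nat) (A B : 'M[F]_n) :
    prime r -> prime s -> A *m B = B *m A ->
    A ^+ r = 1 -> B ^+ s = 1 -> A != 1 -> B != 1 ->
    has_order_mod r #|F| k -> has_order_mod s #|F| l ->
    (0 < k)%N -> (0 < l)%N -> (n < k + l)%N -> (n < 2 * l)%N ->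
  (k %| l)%N.
Proof.
move=> prr prs AB Ar Bs A1 B1 ork osl k0 l0 kl ll.
have stab (X Y : 'M[F]_n) : X *m Y = Y *m X -> ((X - 1) *m Y <= X - 1)%MS.
  by move=> XY; rewrite mulmxBl mul1mx XY -{2}[Y]mulmx1 -mulmxBr submxMl.
have div (t j : nat) (X : 'M[F]_n) : prime t -> (0 < j)%N -> has_order_mod t #|F| j ->
    X ^+ t = 1 -> (j %| \rank (X - 1)%R)%N.
  move=> prt j0 oj Xt; rewrite -oj; apply: (@fixed_point_free_dvdn _ _ (X - 1) X) => //.
    exact: stab.
  move=> v vX vE; apply: (fixed_image_eq0 (s := t)) vE => //.
  exact: has_order_natr_neq0 prt j0 oj.
have rk (j : nat) (X : 'M[F]_n) : X != 1 -> (j %| \rank (X - 1)%R)%N -> (j <= \rank (X - 1)%R)%N.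
  by move=> X1; apply: dvdn_leq; rewrite lt0n mxrank_eq0 subr_eq0.
have kA := rk _ _ A1 (div _ _ _ prr k0 ork Ar).
have lB := div _ _ _ prs l0 osl Bs.
(* The rank is a positive multiple of [l] and at most [n < 2 * l]. *)
have rB : \rank (B - 1) = l.
  have := rk _ _ B1 lB; have /dvdnP[c ce] := lB; rewrite ce.
  have := rank_leq_row (B - 1); rewrite ce; case: c {ce} => [|[|c]]; nia.
pose W := (kermx (A - 1) :&: (B - 1)%R)%MS.
have lW : (l %| \rank W)%N.
  rewrite -osl; apply: (@fixed_point_free_dvdn _ _ W B) => //.
    rewrite sub_capmx; apply/andP; split.
      apply/sub_kermxP; rewrite -mulmxA mulmxBr mulmx1 -AB.
      rewrite -[in X in _ *m (_ - X)](mul1mx B) -mulmxBl mulmxA.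
      by rewrite (sub_kermxP (capmxSl _ _)) mul0mx.
    exact: submx_trans (submxMr _ (capmxSr _ _)) (stab _ _ erefl).
  move=> v; rewrite sub_capmx => /andP[_ vB] vE.
  by apply: (fixed_image_eq0 (s := s)) vE => //; exact: has_order_natr_neq0 prs l0 osl.
have [W0|W0] := posnP (\rank W).
  rewrite -ork -rB; apply: (@fixed_point_free_dvdn _ _ (B - 1) A) => //.
    exact: stab.
  move=> v vB vA; apply/eqP; rewrite -submx0.
  have /eqP <- : W == 0 by rewrite -mxrank_eq0 W0.
  by rewrite sub_capmx vB andbT; apply/sub_kermxP; rewrite mulmxBr mulmx1 vA subrr.
(* Here [l <= \rank W <= n - \rank (A - 1) <= n - k < l]. *)
have := dvdn_leq W0 lW; have : (\rank W <= n - \rank (A - 1)%R)%N.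
  by rewrite -mxrank_ker mxrankS // capmxSl.
by lia.
Qed.

End FixedPointFree.

Lemma has_order_coprime_pred (r q k : nat) : prime r -> (1 < k)%N ->
  has_order_mod r q k -> coprime r q.-1.
Proof.
move=> prr k1 ork; rewrite prime_coprime // -subn1 -{1}(expn1 q) ork.
by rewrite dvdn1 neq_ltn k1 orbT.
Qed.

(** * Lifting elements of a quotient and non-adjacency in PSL *)

Section QuotientOrders.

Variables (gT : finGroupType) (G Z : {group gT}).
Hypothesis nZG : (Z <| G)%g.
Local Open Scope group_scope.

Lemma coset_expg_eq1 (g : gT) (j : nat) :
  g \in G -> (coset Z g ^+ j == 1) = (g ^+ j \in Z).
Proof.
move=> gG; have gN : g \in 'N(Z) by exact: (subsetP (normal_norm nZG)).
rewrite -morphX //; apply/eqP/idP => [|gZ]; last exact: coset_id.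
by apply: coset_idr; apply: groupX.
Qed.

(** For a preimage [g] of [x], the power [g ^+ e] removes the contribution of [Z]; as [m] is coprime
    to [e], its order is exactly [m]. *)
Lemma quotient_lift_order (e m : nat) (x : coset_of Z) :
    {in Z, forall z, z ^+ e = 1} -> coprime m e -> x \in G / Z -> #[x] = m ->
  exists2 y : gT, y ^+ m = 1 & forall j, y ^+ j = 1 -> (m %| j)%N.
Proof.
move=> Ze co /morphimP[g gN gG ->] om; exists (g ^+ e) => [|j].
  by rewrite -expgM mulnC expgM Ze // -coset_expg_eq1 // -order_dvdn om.
rewrite -expgM => gj; rewrite -(@Gauss_dvdr _ e) // -om order_dvdn.
by rewrite coset_expg_eq1 // gj group1.
Qed.

End QuotientOrders.

Section PSLOrders.

Variables (n : nat) (F : finFieldType).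
Hypothesis n1 : (1 < n)%N.
Local Open Scope group_scope.

(** Since [r] and [s] are coprime to [#|F|.-1], [x] yields a matrix [y] of order [r * s]; the
    commuting matrices are [y ^+ s] and [y ^+ r]. *)
Lemma PSL_order_mul_dvdn (r s k l : nat) (x : coset_of 'Z(SL n F)) :
    prime r -> prime s ->
    has_order_mod r #|F| k -> has_order_mod s #|F| l ->
    (1 < k)%N -> (1 < l)%N -> (n < k + l)%N -> (n < 2 * l)%N ->
    x \in PSL n F -> #[x] = (r * s)%N ->
  (k %| l)%N.
Proof.
move=> prr prs ork osl k1 l1 kl ll xG ox.
have co : coprime (r * s) #|F|.-1.
  by rewrite coprimeMl (has_order_coprime_pred prr k1 ork) (has_order_coprime_pred prs l1 osl).
have cZ : {in 'Z(SL n F), forall z, z ^+ #|F|.-1 = 1}.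
  by move=> z; exact: (center_SL_exp n1).
have [y yrs yord] := quotient_lift_order (center_normal _) cZ co xG ox.
have nE : n.-1.+1 = n by rewrite prednK // ltnW.
have r1 := prime_gt1 prr; have s1 := prime_gt1 prs.
apply: (@commuting_large_orders F n.-1 r s k l (GLval (y ^+ s)) (GLval (y ^+ r))) => //;
  rewrite ?nE ?(ltnW k1) ?(ltnW l1) //.
- by rewrite -!GL_MxE -!expgD addnC.
- by rewrite GLvalX -exprM mulnC -GLvalX yrs.
- by rewrite GLvalX -exprM -GLvalX yrs.
- apply/eqP => /(@val_inj _ _ {'GL_n[F]} (y ^+ s) 1) /yord /dvdn_leq.
  by rewrite (ltnW s1) => /(_ isT); rewrite leqNgt ltn_Pmull // ltnW.
- apply/eqP => /(@val_inj _ _ {'GL_n[F]} (y ^+ r) 1) /yord /dvdn_leq.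
  by rewrite (ltnW r1) => /(_ isT); rewrite leqNgt ltn_Pmulr // ltnW.
Qed.

End PSLOrders.

(** * Matrices and elements of PSL of prescribed order *)

Lemma exists_mx_char_poly (R : comNzRingType) (n : nat) (h : {poly R}) :
  h \is monic -> size h = n.+1 -> exists C : 'M[R]_n, char_poly C = h.
Proof.
move=> mh sh; have E : n = (size h).-1 by rewrite sh.
by rewrite {}E; exists (companionmx h); exact: companionmxK.
Qed.

Lemma exists_prim_root_splitting (F : finFieldType) (m : nat) : m%:R != 0 :> F ->
  exists (L : splittingFieldType F) (w : L), m.-primitive_root w.
Proof.
move=> m0; have mgt : (0 < m)%N by case: m m0 => //; rewrite eqxx.
have [|L [zs Dzs _]] := @FinSplittingFieldFor F ('X^m - 1).
  by rewrite -size_poly_gt0 size_XnsubC.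
exists L; rewrite rmorphB rmorph1 /= map_polyXn in Dzs.
have E : 'X^m - 1 = \prod_(z <- zs) ('X - z%:P).
  apply/eqP; rewrite -eqp_monic //; first exact: monicXnsubC.
  exact: monic_prod_XsubC.
have Lm : m%:R != 0 :> L.
  by rewrite -(rmorph_nat (in_alg L)) fmorph_eq0.
have /hasP[w _ pw] : has m.-primitive_root zs; last by exists w.
apply: has_prim_root => //.
- by apply/allP => z; rewrite -root_prod_XsubC -E.
- by rewrite -separable_prod_XsubC -E; exact: separable_Xn_sub_1.
- by rewrite -ltnS -(size_prod_XsubC _ id) -E size_XnsubC.
Qed.

(** The degree is the order of the Galois group of [<<1; w>>], which is cyclic. *)
Lemma adjoin_degree_root_of_unity (F : finFieldType) (L : splittingFieldType F)
    (w : L) (k : nat) : (0 < k)%N ->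
  w ^+ (#|F| ^ k) = w -> (adjoin_degree 1 w <= k)%N.
Proof.
move=> k0 wk.
have sub : (1 <= <<1; w>>)%VS by exact: subv_adjoin.
have [a [ga aE]] := finField_galois_generator sub.
have gal := finField_galois sub.
(* The Frobenius generator [a] of the Galois group satisfies [a ^+ k = 1]. *)
have aX i : (a ^+ i)%g w = w ^+ (#|F| ^ i).
  elim: i => [|i IH]; first by rewrite gal_id expn0 expr1.
  rewrite expgSr galM ?memv_adjoin // aE ?memv_gal ?memv_adjoin //.
  by rewrite IH dimv1 expn1 -exprM expnSr.
have /eqP aG := ga.
have aGal : a \in ('Gal(<<1; w>> / 1))%g by rewrite aG cycle_id.
have ak : (a ^+ k == 1)%g by rewrite gal_adjoin_eq ?groupX ?group1 // aX gal_id wk.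
apply: dvdn_leq => //; have := galois_dim gal.
by rewrite dim_Fadjoin dimv1 muln1 divn1 aG => ->; rewrite -orderE order_dvdn.
Qed.

(** A matrix with a primitive [m]-th root of unity [w] as eigenvalue serves. It is only in GL;
    [exists_PSL_order] moves it into SL. *)
Lemma exists_SL_order_multiple (n : nat) (F : finFieldType) (k m : nat) :
    (0 < k <= n)%N -> m%:R != 0 :> F -> (m %| #|F| ^ k - 1)%N ->
  exists g : {'GL_n[F]}, forall j, (g ^+ j = 1)%g -> (m %| j)%N.
Proof.
move=> /andP[k0 kn] m0 mq; have nE : n.-1.+1 = n by rewrite prednK // (leq_trans k0).
have [L [w pw]] := exists_prim_root_splitting m0.
have q0 : (0 < #|F| ^ k)%N by rewrite expn_gt0; apply/orP; left; apply/card_gt0P; exists 0.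
have wk : w ^+ (#|F| ^ k) = w.
  rewrite -(subnK q0) exprD expr1.
  by have := mq; rewrite (prim_order_dvd pw) => /eqP ->; rewrite mul1r.
have Dk := adjoin_degree_root_of_unity k0 wk.
have /polyOver1P[f fE] := minPolyOver 1 w.
have mon_f : f \is monic.
  by have := monic_minPoly 1 w; rewrite fE map_monic.
have sf : size f = (adjoin_degree 1 w).+1.
  by rewrite -(size_minPoly 1 w) fE size_map_poly.
(* The powers of [X - 1] pad the minimal polynomial of [w] to degree [n] and keep the constant term
   nonzero. *)
pose h := f * ('X - 1%:P) ^+ (n - adjoin_degree 1 w).
have mon_h : h \is monic by rewrite monicMl // monic_exp // monicXsubC.
have sh : size h = n.-1.+2.
  rewrite size_Mmonic ?monic_neq0 ?monic_exp ?monicXsubC // sf size_exp_XsubC nE.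
  by rewrite addnS /= addSn subnKC // (leq_trans Dk).
have [C charC] := exists_mx_char_poly mon_h sh.
have f0 : f.[0] != 0.
  apply: contraTneq pw => f0; apply/negP => pw.
  have : minPoly 1 w %| 'X^m - 1.
    apply: minPoly_dvdp; first by rewrite rpredB ?rpredX ?polyOverX ?rpred1.
    by rewrite rootE !hornerE (prim_expr_order pw) subrr.
  move=> /dvdpP[c /(congr1 (fun P => P.[0]))]; rewrite hornerM fE.
  have -> : (map_poly (in_alg L) f).[0] = 0 by rewrite -(rmorph0 (in_alg L)) horner_map f0 rmorph0.
  rewrite mulr0 !hornerE expr0n eqn0Ngt (prim_order_gt0 pw) sub0r.
  by move/eqP; rewrite oppr_eq0 oner_eq0.
have uC : C \in unitmx.
  rewrite unitmxE unitfE; apply: contraNneq f0 => dC.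
  have := char_poly_det C; rewrite dC mulr0 charC -horner_coef0 hornerM => /eqP.
  rewrite mulf_eq0 => /orP[] //; rewrite horner_exp !hornerE ?sub0r.
  by rewrite expf_eq0 oppr_eq0 oner_eq0 andbF.
exists (FinRing.unit 'M[F]_n.-1.+1 uC : {'GL_n[F]}) => j /(congr1 (@GLval _ _)).
rewrite GLvalX /= => Cj.
have rw : eigenvalue (map_mx (in_alg L) C) w.
  rewrite eigenvalue_root_char -map_char_poly charC rmorphM rootM /=.
  by rewrite -fE root_minPoly.
have [v vC v0] := eigenvalueP rw.
have vX i : v *m (map_mx (in_alg L) C) ^+ i = w ^+ i *: v.
  elim: i => [|i IH]; first by rewrite mulmx1 scale1r.
  by rewrite exprSr mulmxA [v *m _]IH -scalemxAl vC scalerA -exprSr.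
have := vX j; rewrite -rmorphXn /= Cj map_mx1 mulmx1 => /eqP.
rewrite -{1}[v]scale1r -subr_eq0 -scalerBl scaler_eq0 (negPf v0) orbF subr_eq0 eq_sym.
by rewrite -(prim_order_dvd pw).
Qed.

Lemma detX (R : comNzRingType) (n : nat) (A : 'M[R]_n.+1) (j : nat) :
  \det (A ^+ j) = \det A ^+ j.
Proof. by elim: j => [|j IH]; rewrite ?det1 // !exprS -IH -det_mulmx. Qed.

Section Adjacency.

Variables (n : nat) (F : finFieldType).
Local Open Scope group_scope.

Lemma exists_PSL_order (k m : nat) :
    (1 < n)%N -> (0 < k <= n)%N -> (m%:R != 0 :> F)%R -> (m %| #|F| ^ k - 1)%N ->
    coprime m #|F|.-1 ->
  exists2 x, x \in PSL n F & #[x] = m.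
Proof.
move=> n1 kn m0 mk co; have [g gm] := exists_SL_order_multiple kn m0 mk.
have mgt : (0 < m)%N by case: m m0 {mk co gm} => //; rewrite eqxx.
(* This power has determinant 1, and [m] is coprime to the exponent. *)
pose s := g ^+ #|F|.-1.
have sS : s \in SL n F.
  rewrite inE GLvalX detX.
  have d0 : (\det (GLval g) != 0)%R by have := GL_unit g; rewrite unitmxE unitfE.
  have F0 : (0 < #|F|)%N by apply/card_gt0P; exists 0%R.
  by rewrite -(inj_eq (mulIf d0)) /= mul1r -exprSr (prednK F0) expf_card.
have sx : coset 'Z(SL n F) s \in PSL n F by exact: mem_quotient.
(* If the coset has order [o], then [s ^+ o] is central, so [g] to the power [o * #|F|.-1 ^ 2] is 1
   and [m] divides [o]. *)
have mx : (m %| #[coset 'Z(SL n F) s])%N.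
  have := expg_order (coset 'Z(SL n F) s) => /eqP.
  rewrite (coset_expg_eq1 (center_normal _)) // => /(center_SL_exp n1); rewrite -!expgM => /gm.
  by rewrite Gauss_dvdr // Gauss_dvdl.
exists (coset 'Z(SL n F) s ^+ (#[coset 'Z(SL n F) s] %/ m)); first exact: groupX.
by rewrite orderXdiv ?dvdn_div // divnA ?mulKn // ?order_gt0.
Qed.

End Adjacency.

(** * Choice of primes and exponents, and the obstruction to being split *)

Lemma two_primes_same_order (Q t k : nat) :
    (1 < Q)%N -> prime t -> (6 < k)%N -> ~~ (t %| k)%N ->
  exists r r' : nat, [/\ prime r, prime r', r != r',
    has_order_mod r (Q ^ t) k & has_order_mod r' (Q ^ t) k].
Proof.
move=> Q1 prt k6 tk; have t1 := prime_gt1 prt.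
(* [r] has order [t * k] for [Q], hence [k] for [Q ^ t]; [r'] has order [k] for [Q], which passing
   to [Q ^ t] preserves as [t] does not divide [k]. *)
have [|r prr ork] := @Zsigmondy Q (t * k) Q1 _; first by nia.
have [r' prr' ork'] := Zsigmondy Q1 k6.
exists r, r'; split=> // [|j|j]; rewrite -?expnM ?ork ?ork'.
- apply: contraTneq (dvdnn k) => rr'; rewrite -ork' -rr' ork.
  by apply/negP => /dvdn_leq; nia.
- by rewrite dvdn_pmul2l // prime_gt0.
- by rewrite Gauss_dvdr // coprime_sym prime_coprime.
Qed.

(** Two consecutive integers are never both multiples of [t], so four consecutive ones contain two
    nonmultiples. *)
Lemma two_nonmultiples (t n : nat) : (1 < t)%N -> (2 < n)%N ->
  exists k l : nat, [/\ (n <= k + 3)%N, (k < l)%N, (l <= n)%N,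
    ~~ (t %| k)%N & ~~ (t %| l)%N].
Proof.
move=> t1 n3; have -> : n = (n - 3).+3 by lia.
move: (n - 3)%N => m {n n3}.
have succ x : (t %| x)%N -> ~~ (t %| x.+1)%N.
  by move=> tx; rewrite -addn1 dvdn_addr // dvdn1 neq_ltn t1 orbT.
have [d3|d3] := boolP (t %| m.+3)%N; last first.
  have [d2|d2] := boolP (t %| m.+2)%N; last by exists m.+2, m.+3; split => //; lia.
  exists m.+1, m.+3; split => //; try lia.
  by apply: contraTN d2 => /succ.
have d2 : ~~ (t %| m.+2)%N by apply: contraTN d3 => /succ.
have [d1|d1] := boolP (t %| m.+1)%N; last by exists m.+1, m.+2; split => //; lia.
exists m, m.+2; split => //; try lia.
by apply: contraTN d1 => /succ.
Qed.

(** Each edge has an endpoint in the clique, as the other part is independent; these two endpoints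
    would be adjacent. *)
Lemma split_graph_no_2K2 (T : finType) (e : rel T) (a b c d : T) :
    split_graph e -> e a b -> e c d ->
    (forall x y, x \in [:: a; b] -> y \in [:: c; d] -> x != y /\ ~~ e x y) ->
  False.
Proof.
move=> [C [I [CI _ HC HI]]] eab ecd cross.
have inC x y : e x y -> x \notin C -> y \in C.
  move=> exy xC; apply: contraT => yC.
  have inI z : z \notin C -> z \in I.
    by move=> zC; have := in_setT z; rewrite -CI inE (negPf zC).
  by have := HI x y (inI _ xC) (inI _ yC); rewrite exy.
have [x xab xC] : exists2 x, x \in [:: a; b] & x \in C.
  have [aC|aC] := boolP (a \in C); first by exists a => //; rewrite mem_head.
  by exists b; [rewrite !inE eqxx orbT | exact: inC aC].
have [y ycd yC] : exists2 y, y \in [:: c; d] & y \in C.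
  have [cC|cC] := boolP (c \in C); first by exists c => //; rewrite mem_head.
  by exists d; [rewrite !inE eqxx orbT | exact: inC cC].
by have [xy /negP[]] := cross x y xab ycd; exact: HC.
Qed.

Lemma GK_edge (gT : finGroupType) (G : {group gT}) (r s : nat) (x : gT) :
    prime r -> prime s -> r != s -> (x \in G)%g -> #[x]%g = (r * s)%N ->
  exists a b : GK_vertex G, [/\ val a = r, val b = s & GK a b].
Proof.
move=> prr prs rs xG ox.
have mem u : prime u -> (u %| r * s)%N -> u \in primes #|G|.
  move=> pru ud; rewrite mem_primes pru cardG_gt0 /=.
  by apply: dvdn_trans ud _; rewrite -ox order_dvdG.
have rG := mem r prr (dvdn_mulr _ (dvdnn _)).
have sG := mem s prs (dvdn_mull _ (dvdnn _)).
exists (SeqSub rG), (SeqSub sG); split => //; rewrite /GK -val_eqE rs.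
by apply/existsP; exists x; rewrite xG ox eqxx.
Qed.

(* Two disjoint edges of the prime graph with no edge between them *)
Local Close Scope ring_scope.

Theorem proposition7p1 (p q n : nat) (F : finFieldType)
    (hp : prime p) (hq : exists2 k : nat, 0 < k & q = p ^ k) (hF : #|F| = q)
    (hqp : p < q) (hn : 11 < n) :
  ~ split_graph (@GK _ (PSL n F)).
Proof.
case: hq => K K0 qK.
have K1 : (1 < K)%N.
  by move: hqp; rewrite qK -{1}(expn1 p) ltn_exp2l // prime_gt1.
pose t := pdiv K; have prt : prime t by exact: pdiv_prime.
pose Q := (p ^ (K %/ t))%N.
have Q1 : (1 < Q)%N.
  rewrite -(expn0 p) ltn_exp2l ?prime_gt1 // divn_gt0 ?pdiv_gt0 //.
  by rewrite dvdn_leq // pdiv_dvd.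
have FQ : #|F| = (Q ^ t)%N by rewrite hF qK -expnM divnK // pdiv_dvd.
have n1 : (1 < n)%N by exact: leq_trans hn.
have n2 : (2 < n)%N by exact: leq_trans hn.
have [k [l [nk kl ln tk tl]]] := two_nonmultiples (prime_gt1 prt) n2.
have [k6 l6 kn nkl nl] : [/\ 6 < k, 6 < l, k <= n, n < k + l & n < 2 * l].
  by clear - hn nk kl ln; split; lia.
have k1 : 1 < k by exact: leq_trans k6.
have l1 : 1 < l by exact: leq_trans l6.
(* [k < l <= k + 3 < 2 * k], since [k >= 9]. *)
have kNl : ~~ (k %| l).
  by clear - hn nk kl ln; apply/negP => /dvdnP[[|[|m]] lE]; nia.
have edge j : (6 < j)%N -> (j <= n)%N -> ~~ (t %| j)%N ->
    exists a b : GK_vertex (PSL n F), [/\ GK a b,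
      has_order_mod (val a) #|F| j & has_order_mod (val b) #|F| j].
  move=> j6 jn tj; have [r [r' [prr prr' rr' orr orr']]] := two_primes_same_order Q1 prt j6 tj.
  rewrite -FQ in orr orr'.
  have j0 : (0 < j)%N by apply: leq_trans j6.
  have j1 : (1 < j)%N by apply: leq_trans j6.
  have j0n : (0 < j <= n) by rewrite j0.
  have rr0 : ((r * r')%:R != 0 :> F)%R.
    by rewrite natrM mulf_neq0 // (@has_order_natr_neq0 F _ j).
  have rrq : r * r' %| #|F| ^ j - 1.
    by rewrite Gauss_dvd ?orr ?orr' ?dvdnn // prime_coprime // dvdn_prime2.
  have co : coprime (r * r') #|F|.-1.
    by rewrite coprimeMl (has_order_coprime_pred prr j1 orr) (has_order_coprime_pred prr' j1 orr').
  have [x xG ox] := exists_PSL_order n1 j0n rr0 rrq co.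
  have [a [b [va vb ab]]] := GK_edge prr prr' rr' xG ox.
  by exists a, b; rewrite va vb.
have [a [b [eab oa ob]]] := edge k k6 kn tk.
have [c [d [ecd oc od]]] := edge l l6 ln tl.
move=> /split_graph_no_2K2 /(_ eab ecd); apply => x y xab ycd.
have ox : has_order_mod (val x) #|F| k by move: xab; rewrite !inE => /orP[]/eqP->.
have oy : has_order_mod (val y) #|F| l by move: ycd; rewrite !inE => /orP[]/eqP->.
(* One prime cannot have both orders [k] and [l]. *)
have xy : x != y by apply: contraNneq kNl => xy; rewrite -ox xy oy.
split=> //; apply/negP => /andP[_ /existsP[g /andP[gG /eqP og]]].
have prv (v : GK_vertex (PSL n F)) : prime (val v).
  by have := valP v; rewrite mem_primes => /and3P[].
case/negP: kNl; exact: (PSL_order_mul_dvdn n1 (prv x) (prv y) ox oy k1 l1 nkl nl gG og).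
Qed.
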